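(* Let $c>0$ be a fixed real number. For each integer $n\ge2$ put $\theta=1-1/n$ and $k=\lfloor n\log n+cn\rfloor$, and let $$\ell(k,n)=\sum_{w\in\mathfrak{S}_n}\prod_{j=1}^n\left(\theta^j+(1-\theta)^j\right)^{k\,n_j(w)} .$$ Then, as $n\to\infty$, $$\ell(k,n)\;\sim\;\exp\left(\sum_{j=2}^\infty\frac{e^{-jc}}{j}\right)=\frac{e^{-e^{-c}}}{1-e^{-c}} .$$
   Context: $\mathfrak{S}_n$ is the symmetric group on $n$ letters and $n_j(w)$ is the number of $j$-cycles of the permutation $w$. The notation $a_n\sim b_n$ means $a_n/b_n\to1$. *)

(* Defs.v *)
From HB Require Import structures.
From mathcomp Require Import all_boot all_order all_algebra all_fingroup.
From mathcomp Require Import all_classical all_reals all_analysis.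
Set Implicit Arguments.
Unset Strict Implicit.
Unset Printing Implicit Defensive.
Import Order.TTheory GRing.Theory Num.Theory numFieldNormedType.Exports.
Local Open Scope classical_set_scope.
Local Open Scope ring_scope.

(* 'porbits w' is the set of all cycles of w, fixed points included. *)
Definition ncycles (n : nat) (w : 'S_n) (j : nat) : nat :=
  #|[set C in porbits w | #|C| == j]|.

Definition ell (R : realType) (theta : R) (k n : nat) : R :=
  \sum_(w : 'S_n)
    \prod_(1 <= j < n.+1)
      (theta ^+ j + (1 - theta) ^+ j) ^+ (k * ncycles w j).

Definition asymp_equiv (R : realType) (a b : nat -> R) : Prop :=
  (fun n : nat => a n / b n) @ \oo --> (1 : R).

Definition theta_of (R : realType) (n : nat) : R := 1 - n%:R^-1.

(* For c > 0 and n >= 1 the argument is positive, so that 'Num.truncn' is the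
   floor; the value at n = 0 is irrelevant to the asymptotics. *)
Definition k_of (R : realType) (c : R) (n : nat) : nat :=
  Num.truncn (n%:R * ln (n%:R : R) + c * n%:R).

Definition psum_ge2 (R : realType) (c : R) (N : nat) : R :=
  \sum_(2 <= j < N) expR (- (j%:R * c)) / j%:R.

(* Main.v *)
Require Import Defs.
From HB Require Import structures.
From mathcomp Require Import all_boot all_order all_algebra all_fingroup.
From mathcomp Require Import all_classical all_reals all_analysis.
From mathcomp Require Import ring lra.
Set Implicit Arguments.
Unset Strict Implicit.
Unset Printing Implicit Defensive.
Import Order.TTheory GRing.Theory Num.Theory numFieldNormedType.Exports.
Local Open Scope classical_set_scope.
Local Open Scope ring_scope.

(** Give every non-fixed point of a permutation the weight y, so that w has
    weight y^m with m its number of non-fixed points.  When theta = 1 - 1/n,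
    a fixed point contributes the factor 1 to the weight of w in ell(k,n),
    while a cycle of length j >= 2 contributes a factor that differs from
    theta^(jk), about e^(-jk/n), only by the term (1-theta)^j, which is
    negligible.  Hence ell(k,n) lies between two sums
    F(n,y) = sum_w y^(number of non-fixed points of w) with parameters y
    satisfying n y -> e^(-c) ([ell_sandwich], [cvg_y_low], [cvg_y_upp]).

    The sum F(n,y) is the permanent of y J + (1-y) I, where J is the all-ones
    matrix.  Expanding each row sum over the two summands leaves, for each set
    of m rows using J, the m! permutations supported there, so
    F(n,y) = sum_m n(n-1)...(n-m+1) y^m (1-y)^(n-m)  ([sum_perm_nonfixed]).
    If n y -> u < 1, the m-th term tends to u^m e^(-u) and is dominated by a
    geometric series, whence F(n,y) -> e^(-u)/(1-u)  ([cvg_nonfixed_gf]).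
    With u = e^(-c) this is the limit of ell(k,n).

    The exponent sum_(j>=2) u^j/j equals -ln(1-u) - u by the logarithmic
    series, which the mean value theorem gives with an explicit remainder
    ([le_lnB_sum], [cvg_psum_ge2]). *)

(** * Permutations counted by their non-fixed points *)

Lemma card_porbit_eq1 (T : finType) (w : {perm T}) (i : T) :
  (#|porbit w i| == 1%N) = (w i == i).
Proof.
apply/idP/eqP => [/cards1P[j wj]|wi].
  have: w i \in porbit w i by have := mem_porbit w 1 i; rewrite expg1.
  have: i \in porbit w i by exact: porbit_id.
  by rewrite wj !inE => /eqP -> /eqP ->.
suff -> : porbit w i = [set i]%SET by rewrite cards1.
apply/setP => j; rewrite inE; apply/porbitP/eqP => [[k ->]|->].
  by elim: k => [|k IH]; rewrite ?expg0 ?perm1 // expgSr permM IH wi.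
by exists 0%N; rewrite expg0 perm1.
Qed.

Lemma card_porbits_ge1 (T : finType) (w : {perm T}) (C : {set T}) :
  C \in porbits w -> (0 < #|C|)%N.
Proof. by move=> /imsetP[i _ ->]; rewrite lt0n card_porbit_neq0. Qed.

(** Exchanging the product over lengths with the product over cycles replaces
    cycle counts by a product of one factor per cycle. *)
Lemma prod_ncycles (R : comPzRingType) (n k : nat) (w : 'S_n) (f : nat -> R) :
  \prod_(1 <= j < n.+1) f j ^+ (k * ncycles w j) =
  \prod_(C in porbits w) f #|C| ^+ k.
Proof.
transitivity (\prod_(1 <= j < n.+1) \prod_(C in porbits w | #|C| == j)
                f #|C| ^+ k).
  apply: eq_bigr => j _; rewrite mulnC exprM.
  rewrite [RHS](eq_bigr (fun=> f j ^+ k)); last by move=> C /andP[_ /eqP ->].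
  rewrite (eq_bigl (mem [set C in porbits w | #|C| == j]%SET)).
    by rewrite prodr_const -!exprM mulnC.
  by move=> C; rewrite !inE.
rewrite (exchange_big_dep (mem (porbits w))) /=; last by move=> j C _ /andP[].
apply: eq_bigr => C Cw.
rewrite (eq_bigl (fun j => j == #|C|)) => [|j]; last first.
  by rewrite Cw eq_sym.
rewrite big_nat1_eq ltnS (card_porbits_ge1 Cw) /=.
by have := max_card (mem C); rewrite card_ord => ->.
Qed.

Lemma prod_porbits (R : comPzRingType) (T : finType) (w : {perm T})
    (g : T -> R) :
  \prod_i g i = \prod_(C in porbits w) \prod_(i in C) g i.
Proof.
rewrite (partition_big (porbit w) (mem (porbits w))) => [|i _] /=; last first.
  by apply/imsetP; exists i.
apply: eq_bigr => C /imsetP[x _ ->]; apply: eq_bigl => i.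
by rewrite eq_porbit_mem.
Qed.

Lemma sum_subsets_card (R : pzRingType) (T : finType) (g : nat -> R) :
  \sum_(J : {set T}) g #|J| = \sum_(m < #|T|.+1) g m *+ 'C(#|T|, m).
Proof.
rewrite (partition_big (fun J : {set T} => inord #|J| : 'I_#|T|.+1) predT) //=.
apply: eq_bigr => m _.
have E (J : {set T}) : (inord #|J| == m) = (#|J| == m).
  by rewrite -val_eqE /= inordK // ltnS max_card.
rewrite (eq_bigr (fun=> g m)) => [|J]; last by rewrite E => /eqP ->.
rewrite (eq_bigl (mem [set J : {set T} | #|J| == m]%SET)).
  by rewrite sumr_const card_draws.
by move=> J; rewrite !inE E.
Qed.

(** Closed form of the sum over permutations of n points of y to the number of
    non-fixed points; [sum_perm_nonfixed] is the identification. *)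
Definition nonfixed_gf (R : pzRingType) (n : nat) (y : R) : R :=
  \sum_(m < n.+1) y ^+ m * (1 - y) ^+ (n - m) *+ (n ^_ m).

(** The weight of a point is y + (1-y)[w i = i].  Expanding the product over
    points, a set J contributes y^|J| (1-y)^(n-|J|) exactly for those w that fix
    everything outside J, and there are |J|! of them. *)
Lemma sum_perm_nonfixed (R : comPzRingType) (T : finType) (y : R) :
  \sum_(w : {perm T}) \prod_i (if w i == i then 1 else y) =
  nonfixed_gf #|T| y.
Proof.
pose G m := y ^+ m * (1 - y) ^+ (#|T| - m).
transitivity (\sum_(w : {perm T}) \sum_(J : {set T})
                 if perm_on J w then G #|J| else 0).
  apply: eq_bigr => w _.
  transitivity (\prod_i (y + (if w i == i then 1 - y else 0))).
    by apply: eq_bigr => i _; case: ifP; rewrite ?addr0 // addrC subrK.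
  rewrite bigA_distr; apply: eq_bigr => J _.
  case: ifPn => [/fintype.subsetP wJ|/fintype.subsetPn[i]]; last first.
    by rewrite inE => /negPf wi /negPf iJ; rewrite (bigD1 i) //= iJ wi mul0r.
  rewrite (bigID (mem J)) /=; congr (_ * _).
    by rewrite (eq_bigr (fun=> y)) => [|i -> //]; rewrite prodr_const.
  rewrite (eq_bigr (fun=> 1 - y)) => [|i iJ]; last first.
    rewrite (negPf iJ) ifT //; apply: contraR iJ => wi.
    by apply: wJ; rewrite inE.
  rewrite prodr_const; congr (_ ^+ _).
  rewrite -(finset.setCK J) -cardsCs finset.setCK.
  by apply: eq_card => i; rewrite !inE.
rewrite exchange_big /=.
under eq_bigr => J _ do
  rewrite -big_mkcond sumr_const card_perm.
rewrite (sum_subsets_card _ (fun m => G m *+ m`!)).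
by apply: eq_bigr => m _; rewrite -mulrnA mulnC bin_ffact.
Qed.

(** * Comparison of the cycle weights with non-fixed point weights *)

Lemma prod_cycle_nonfixed (R : comPzRingType) (T : finType) (w : {perm T})
    (C : {set T}) (y : R) : C \in porbits w ->
  \prod_(i in C) (if w i == i then 1 else y) =
  if #|C| == 1%N then 1 else y ^+ #|C|.
Proof.
case/imsetP=> x _ ->.
rewrite (eq_bigr (fun=> if #|porbit w x| == 1%N then 1 else y)); last first.
  by move=> i; rewrite -eq_porbit_mem => /eqP <-; rewrite card_porbit_eq1.
by rewrite prodr_const; case: ifP => //; rewrite expr1n.
Qed.

Lemma nonfixed_gf_porbits (R : comPzRingType) (n : nat) (y : R) :
  nonfixed_gf n y =
  \sum_(w : 'S_n) \prod_(C in porbits w)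
    (if #|C| == 1%N then 1 else y ^+ #|C|).
Proof.
rewrite -[n in LHS]card_ord -sum_perm_nonfixed; apply: eq_bigr => w _.
by rewrite (prod_porbits w); apply: eq_bigr => C Cw; rewrite prod_cycle_nonfixed.
Qed.

Lemma ell_porbits (R : realType) (theta : R) (k n : nat) :
  ell theta k n =
  \sum_(w : 'S_n) \prod_(C in porbits w)
    (theta ^+ #|C| + (1 - theta) ^+ #|C|) ^+ k.
Proof.
apply: eq_bigr => w _.
exact: (prod_ncycles k w (fun j => theta ^+ j + (1 - theta) ^+ j)).
Qed.

(** Comparing cycle by cycle is enough, and only for cycles of length at least
    2: a fixed point has weight theta + (1 - theta) = 1 on both sides. *)
Lemma nonfixed_gf_le_ell (R : realType) (theta y : R) (k n : nat) :
  0 <= y ->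
  (forall j, (1 < j)%N -> y ^+ j <= (theta ^+ j + (1 - theta) ^+ j) ^+ k) ->
  nonfixed_gf n y <= ell theta k n.
Proof.
move=> y0 yle; rewrite nonfixed_gf_porbits ell_porbits.
apply: ler_sum => w _; apply: ler_prod => C Cw.
have := card_porbits_ge1 Cw; rewrite leq_eqVlt eq_sym; case: eqP => [->|_] /= C1.
  by rewrite !expr1 addrC subrK expr1n ler01 lexx.
by rewrite exprn_ge0 ?yle.
Qed.

Lemma ell_le_nonfixed_gf (R : realType) (theta y : R) (k n : nat) :
  0 <= theta <= 1 ->
  (forall j, (1 < j)%N -> (theta ^+ j + (1 - theta) ^+ j) ^+ k <= y ^+ j) ->
  ell theta k n <= nonfixed_gf n y.
Proof.
move=> /andP[t0 t1] yge; rewrite nonfixed_gf_porbits ell_porbits.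
apply: ler_sum => w _; apply: ler_prod => C Cw.
have := card_porbits_ge1 Cw; rewrite leq_eqVlt eq_sym; case: eqP => [->|_] /= C1.
  by rewrite !expr1 addrC subrK expr1n ler01 lexx.
by rewrite exprn_ge0 ?yge // addr_ge0 // exprn_ge0 // subr_ge0.
Qed.

(** The parameters come from exp(-1/(n-1)) <= 1 - 1/n <= exp(-1/n); the
    correction 1/(n-1)^2 in the upper one absorbs the term (1-theta)^j. *)
Definition y_low (R : realType) (k n : nat) : R := expR (- (k%:R / n.-1%:R)).

Definition y_upp (R : realType) (k n : nat) : R :=
  expR (- (k%:R / n%:R) + k%:R / n.-1%:R ^+ 2).

(** With q = (1-theta)/theta = 1/(n-1), a cycle of length j has weight
    (theta^j (1 + q^j))^k.  It is at least theta^(jk) and, for j >= 2, at most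
    (theta (1 + q^2))^(jk). *)
Lemma ell_sandwich (R : realType) (k n : nat) : (1 < n)%N ->
  nonfixed_gf n (y_low R k n) <= ell (theta_of R n) k n
    <= nonfixed_gf n (y_upp R k n).
Proof.
case: n => [//|n]; rewrite ltnS => n0.
have nR : 0 < n%:R :> R by rewrite ltr0n.
have n1R : 1 <= n%:R :> R by rewrite ler1n.
(* n stands for the degree minus 1, so that q = (1 - t) / t = 1 / n. *)
rewrite /theta_of; set t : R := 1 - _; set q : R := n%:R^-1.
have tE : t = n%:R / (n%:R + 1).
  by rewrite /t -natr1; field; rewrite gt_eqF // ltr_wpDl // ltW.
have t0 : 0 < t by rewrite tE divr_gt0 // ltr_wpDl // ltW.
have tq : 1 - t = t * q.
  by rewrite tE /q; field; rewrite !gt_eqF // ltr_wpDl // ltW.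
have q0 : 0 < q by rewrite invr_gt0.
have q1 : q <= 1 by rewrite invf_le1.
have t1 : t <= 1 by rewrite -subr_ge0 tq mulr_ge0 // ltW.
apply/andP; split.
- apply: nonfixed_gf_le_ell; first exact: expR_ge0.
  move=> j _; rewrite /y_low /= -mulrN expRM_natl -exprM mulnC exprM.
  rewrite lerXn2r ?nnegrE ?exprn_ge0 ?expR_ge0 //.
    by rewrite addr_ge0 // exprn_ge0 // ?ltW // tq mulr_gt0.
  rewrite (@le_trans _ _ (t ^+ j)) //; last first.
    by rewrite lerDl exprn_ge0 // tq mulr_ge0 // ltW.
  rewrite lerXn2r ?nnegrE ?expR_ge0 ?(ltW t0) //.
  have -> : t = (1 + q)^-1.
    by rewrite tE /q; field; rewrite !gt_eqF // ltr_wpDl // ltW.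
  rewrite expRN lef_pV2 ?posrE ?expR_gt0 ?expR_ge1Dx //.
  by rewrite ltr_pwDl // ltW.
- apply: ell_le_nonfixed_gf; first by rewrite ltW.
  move=> j j1; rewrite /y_upp /=.
  rewrite -[k%:R / n.+1%:R]/(k%:R * n.+1%:R^-1) -mulrN -mulrDr expRM_natl.
  rewrite -[leRHS]exprM [in leRHS]mulnC [leRHS]exprM.
  rewrite lerXn2r ?nnegrE ?exprn_ge0 ?expR_ge0 //.
    by rewrite addr_ge0 // exprn_ge0 // ?ltW // tq mulr_gt0.
  rewrite tq exprMn -[X in X + _]mulr1 -mulrDr expRD exprMn.
  rewrite ler_pM ?exprn_ge0 ?(ltW t0) ?addr_ge0 ?exprn_ge0 ?(ltW q0) //.
    by rewrite lerXn2r ?nnegrE ?expR_ge0 ?(ltW t0) // expR_ge1Dx.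
  rewrite (@le_trans _ _ (1 + q ^+ 2)) //.
    by rewrite lerD2l ler_wiXn2l // ltW.
  rewrite -[n%:R^-1 ^+ 2]/(q ^+ 2) -exprVn (le_trans (expR_ge1Dx _)) //.
  rewrite -[leLHS]expr1 ler_weXn2l //; last exact: ltnW.
  by rewrite -expR0 ler_expR exprn_ge0 // ltW.
Qed.

(** * Asymptotics of the non-fixed point sum *)

Lemma ffact_le_expn (n m : nat) : (n ^_ m <= n ^ m)%N.
Proof.
by elim: m => [//|m IH]; rewrite ffactnSr expnSr leq_mul // leq_subr.
Qed.

Lemma expn_le_ffact (n m : nat) : ((n - m) ^ m <= n ^_ m)%N.
Proof.
elim: m => [//|m IH]; rewrite ffactnSr expnSr leq_mul ?leq_sub2l //.
apply: leq_trans IH; case: m => [//|m].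
by rewrite leq_exp2r ?leq_sub2l.
Qed.

(** Bounding the falling factorial by n^m turns the sum into (1-y)^n times a
    geometric series of ratio n y / (1-y). *)
Lemma nonfixed_gf_le (R : realType) (n : nat) (y : R) :
  0 <= y < 1 -> n%:R * (y / (1 - y)) < 1 ->
  nonfixed_gf n y <= (1 - y) ^+ n / (1 - n%:R * (y / (1 - y))).
Proof.
move=> /andP[y0 y1] r1; set r := n%:R * _ in r1 *.
have z0 : 0 < 1 - y by rewrite subr_gt0.
have r0 : 0 <= r by rewrite mulr_ge0 // divr_ge0 // ltW.
apply: (@le_trans _ _ (\sum_(m < n.+1) (1 - y) ^+ n * r ^+ m)).
  apply: ler_sum => m _.
  have mn : (m <= n)%N by rewrite -ltnS.
  rewrite -[X in _ <= _ ^+ X * _](subnK mn) exprD /r !exprMn exprVn.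
  have -> : (1 - y) ^+ (n - m) * (1 - y) ^+ m *
      (n%:R ^+ m * (y ^+ m * (1 - y) ^- m)) =
      (n%:R ^+ m) * (y ^+ m * (1 - y) ^+ (n - m)).
    by field; rewrite expf_neq0 // gt_eqF.
  rewrite -mulr_natl ler_wpM2r ?mulr_ge0 ?exprn_ge0 // ?(ltW z0) //.
  by rewrite -natrX ler_nat ffact_le_expn.
rewrite -mulr_sumr ler_pM2l ?exprn_gt0 // -(big_mkord predT (fun m => r ^+ m)).
have -> : \sum_(0 <= m < n.+1) r ^+ m = series (geometric 1 r) n.+1.
  by rewrite /series /=; apply: eq_bigr => m _; rewrite mul1r.
rewrite geometric_seriesE ?lt_eqF //= mul1r ler_pdivrMr ?subr_gt0 //.
by rewrite mulVf ?gt_eqF ?subr_gt0 // gerBl exprn_ge0.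
Qed.

(** Keeping boundedly many terms loses little, and each of them has an
    elementary limit when n y converges. *)
Lemma nonfixed_gf_ge (R : realType) (n M : nat) (y : R) :
  0 <= y < 1 -> (M <= n.+1)%N ->
  (1 - y) ^+ n * \sum_(m < M) ((n - m)%:R * y) ^+ m <= nonfixed_gf n y.
Proof.
move=> /andP[y0 y1] Mn.
have z0 : 0 <= 1 - y by rewrite subr_ge0 ltW.
pose G m := y ^+ m * (1 - y) ^+ (n - m) *+ (n ^_ m).
have G0 m : 0 <= G m by rewrite mulrn_wge0 // mulr_ge0 // exprn_ge0.
apply: (@le_trans _ _ (\sum_(m < M) G m)).
  rewrite mulr_sumr; apply: ler_sum => m _.
  have mn : (m <= n)%N by rewrite -ltnS (leq_trans _ Mn).
  rewrite /G -[leRHS]mulr_natl exprMn [leLHS]mulrC -[leLHS]mulrA.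
  apply: ler_pM; rewrite ?exprn_ge0 // ?mulr_ge0 ?exprn_ge0 //.
    by rewrite -natrX ler_nat expn_le_ffact.
  rewrite ler_wpM2l ?exprn_ge0 // ler_wiXn2l ?leq_subr //.
  by rewrite gerBl.
rewrite /nonfixed_gf -!(big_mkord predT G) (@big_cat_nat _ _ _ M 0 n.+1) //=.
by rewrite lerDl sumr_ge0.
Qed.


Lemma cvg_invn (R : realType) : n%:R^-1 @[n --> \oo] --> (0 : R).
Proof. by rewrite -(cvg_shiftS (fun n => n%:R^-1 : R)); exact: (@cvg_harmonic R). Qed.

Lemma cvg_of_natmul (R : realType) (y : nat -> R) (u : R) :
  n%:R * y n @[n --> \oo] --> u -> y n @[n --> \oo] --> (0 : R).
Proof.
move=> ny; have : n%:R * y n * n%:R^-1 @[n --> \oo] --> u * 0.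
  exact: cvgM ny (@cvg_invn R).
rewrite mulr0; apply: cvg_trans.
apply: near_eq_cvg; near=> n => /=.
have n0 : n%:R != 0 :> R by rewrite pnatr_eq0 -lt0n; near: n; exact: nbhs_infty_gt.
by rewrite mulrAC divff // mul1r.
Unshelve. all: by end_near. Qed.

Lemma cvg_expR_seq (R : realType) (a : nat -> R) (l : R) :
  a n @[n --> \oo] --> l -> expR (a n) @[n --> \oo] --> expR l.
Proof. by move=> al; apply: continuous_cvg => //; exact: continuous_expR. Qed.

Lemma cvg_oneB_inv (R : realType) (y : nat -> R) :
  y n @[n --> \oo] --> (0 : R) -> (1 - y n)^-1 @[n --> \oo] --> (1 : R).
Proof.
move=> yc; rewrite -[X in _ --> X]invr1; apply: cvgV; first exact: oner_neq0.
rewrite -[X in _ --> X]subr0; apply: cvgB yc; exact: cvg_cst.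
Qed.

(** Squeeze between exp(-ny/(1-y)) and exp(-ny), which come from
    exp(-y/(1-y)) <= 1 - y <= exp(-y). *)
Lemma cvg_oneB_exp (R : realType) (y : nat -> R) (u : R) :
  (forall n, 0 <= y n) -> n%:R * y n @[n --> \oo] --> u ->
  (1 - y n) ^+ n @[n --> \oo] --> expR (- u).
Proof.
move=> y0 ny; have yc := cvg_of_natmul ny.
have zc := cvg_oneB_inv yc.
apply: (@squeeze_cvgr _ _ _ _ (fun n => expR (- (n%:R * y n * (1 - y n)^-1)))
  (fun n => expR (- (n%:R * y n)))).
- near=> n.
  have y1 : 0 < 1 - y n.
    by rewrite subr_gt0; near: n; apply: (cvgr_lt 0) => //; exact: yc.
  apply/andP; split; last first.
    rewrite -mulrN expRM_natl lerXn2r ?nnegrE ?expR_ge0 ?(ltW y1) //.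
    exact: expR_ge1Dx.
  rewrite -mulrA -mulrN expRM_natl lerXn2r ?nnegrE ?expR_ge0 ?(ltW y1) //.
  have zE : 1 - y n = (1 + y n * (1 - y n)^-1)^-1.
    by field; rewrite gt_eqF //= addrNK oner_neq0.
  rewrite [leRHS]zE expRN lef_pV2 ?posrE ?expR_gt0 ?expR_ge1Dx //.
  by rewrite ltr_pwDl // divr_ge0 // ltW.
- apply: cvg_expR_seq; apply: cvgN.
  by rewrite -[u]mulr1; apply: cvgM.
- by apply: cvg_expR_seq; apply: cvgN.
Unshelve. all: by end_near. Qed.

Lemma cvg_exp_seq (R : realType) (a : nat -> R) (l : R) (m : nat) :
  a n @[n --> \oo] --> l -> a n ^+ m @[n --> \oo] --> l ^+ m.
Proof. 
move=> al.
apply: (@continuous_cvg _ R R _ _ a (fun x => x ^+ m) l) => //.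
exact: exprn_continuous. Qed.

(** The upper bound [nonfixed_gf_le] already has the right limit.  The lower
    bound [nonfixed_gf_ge] with M terms tends to e^(-u) (1 + u + ... + u^(M-1)),
    which is within any epsilon of it once M is large. *)
Lemma cvg_nonfixed_gf (R : realType) (y : nat -> R) (u : R) :
  0 < u < 1 -> (forall n, 0 <= y n) -> n%:R * y n @[n --> \oo] --> u ->
  nonfixed_gf n (y n) @[n --> \oo] --> expR (- u) / (1 - u).
Proof.
move=> /andP[u0 u1] y0 ny; have yc := cvg_of_natmul ny.
have ec := cvg_oneB_exp y0 ny.
have y1 : \forall n \near \oo, 0 <= y n < 1.
  by near=> n; rewrite y0 /=; near: n; apply: (cvgr_lt 0).
have rc : n%:R * (y n / (1 - y n)) @[n --> \oo] --> u.
  have : n%:R * y n * (1 - y n)^-1 @[n --> \oo] --> u * 1.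
    exact: cvgM ny (cvg_oneB_inv yc).
  by rewrite mulr1; under eq_fun do rewrite -mulrA.
have uc : (1 - y n) ^+ n / (1 - n%:R * (y n / (1 - y n))) @[n --> \oo]
    --> expR (- u) / (1 - u).
  apply: cvgM ec _; apply: cvgV; first by rewrite gt_eqF // subr_gt0.
  by apply: cvgB rc; exact: cvg_cst.
have lc M : (1 - y n) ^+ n * \sum_(m < M) ((n - m)%:R * y n) ^+ m
    @[n --> \oo] --> expR (- u) * \sum_(m < M) u ^+ m.
  apply: cvgM ec _; apply: cvg_big => [|m _]; first exact: add_continuous.
  apply: cvg_exp_seq.
  have : n%:R * y n - m%:R * y n @[n --> \oo] --> u - m%:R * 0.
    by apply: cvgB ny _; apply: cvgM yc; exact: cvg_cst.
  rewrite mulr0 subr0; apply: cvg_trans; apply: near_eq_cvg; near=> n.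
  rewrite -mulrBl natrB //; near: n; exact: nbhs_infty_ge.
have Mc : expR (- u) * \sum_(m < M) u ^+ m @[M --> \oo]
    --> expR (- u) / (1 - u).
  apply: cvgM; first exact: cvg_cst.
  have -> : (fun M => \sum_(m < M) u ^+ m) = series (geometric 1 u).
    apply/funext => M; rewrite /series /= big_mkord.
    by apply: eq_bigr => m _; rewrite mul1r.
  by rewrite -[X in _ --> X]mul1r; apply: cvg_geometric_series; rewrite gtr0_norm.
apply/cvgrPdist_lt => e e0.
(* M is fixed before n, so that the truncated sum has a limit in n. *)
have [M ML] : exists M, expR (- u) / (1 - u) - e <
    expR (- u) * \sum_(m < M) u ^+ m.
  apply: (@filter_ex _ \oo); apply: (cvgr_gt _ Mc).
  by rewrite gtrDl oppr_lt0.
near=> n; rewrite distrC ltr_distl; apply/andP; split.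
- apply: (@lt_le_trans _ _ _ _ _ _ (nonfixed_gf_ge (M := M) _ _)).
  + near: n; exact: (cvgr_gt _ (lc M)).
  + by near: n.
  + by rewrite leqW //; near: n; exact: nbhs_infty_ge.
- apply: (le_lt_trans (nonfixed_gf_le _ _)).
  + by near: n.
  + by near: n; apply: (cvgr_lt u).
  + by near: n; apply: (cvgr_lt _ uc); rewrite ltrDl.
Unshelve. all: by end_near. Qed.

(** * The scaling n y -> exp(-c) *)

Lemma cvg_sqrt_invn (R : realType) :
  Num.sqrt (n%:R^-1) @[n --> \oo] --> (0 : R).
Proof.
rewrite -[X in _ --> X](@sqrtr0 R).
apply: (@continuous_cvg _ R R _ _ (fun n => n%:R^-1) Num.sqrt 0).
  exact: sqrt_continuous.
exact: cvg_invn.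
Qed.

(** Halving the logarithm: ln x = 2 ln (sqrt x). *)
Lemma ln_le_sqrt (R : realType) (x : R) : 0 < x -> ln x <= 2 * Num.sqrt x.
Proof.
move=> x0; have s0 : 0 < Num.sqrt x by rewrite sqrtr_gt0.
have -> : ln x = ln (Num.sqrt x) + ln (Num.sqrt x).
  by rewrite -lnM ?posrE // -expr2 sqr_sqrtr ?ltW.
by have := ln_sublinear s0; lra.
Qed.

Lemma cvg_ln_div (R : realType) : ln n%:R / n.-1%:R @[n --> \oo] --> (0 : R).
Proof.
apply: (@squeeze_cvgr _ _ _ _ (fun=> 0) (fun n => 4 * Num.sqrt (n%:R^-1))).
- near=> n.
  have n1 : (1 < n)%N by near: n; exact: nbhs_infty_gt.
  have n0 : (0 < n)%N by exact: ltnW.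
  have nR : 0 < n%:R :> R by rewrite ltr0n.
  have mR : 0 < n.-1%:R :> R by rewrite ltr0n -ltnS prednK.
  have lnn : 0 <= ln (n%:R : R) by rewrite ln_ge0 // ler1n.
  rewrite divr_ge0 //= ler_pdivrMr //.
  apply: (le_trans (ln_le_sqrt nR)).
  have s0 : 0 < Num.sqrt (n%:R : R) by rewrite sqrtr_gt0.
  have n2 : n%:R <= 2 * n.-1%:R :> R.
    rewrite -natrM ler_nat mul2n -addnn -{1}(prednK n0) -add1n leq_add2r.
    by rewrite -ltnS prednK.
  rewrite sqrtrV // -(ler_pM2r s0) -[leLHS]mulrA -expr2 sqr_sqrtr ?(ltW nR) //.
  by rewrite [leRHS]mulrAC divfK ?gt_eqF //; lra.
- exact: cvg_cst.
- by rewrite -[X in _ --> X](mulr0 4); apply: cvgM (@cvg_sqrt_invn R); exact: cvg_cst.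
Unshelve. all: by end_near. Qed.

Section Scaling.
Variables (R : realType) (c : R).
Hypothesis c_gt0 : 0 < c.

(** Rounding down n ln n + c n costs at most 1, hence 1/n after division. *)
Lemma k_of_div_bounds (n : nat) : (0 < n)%N ->
  c - n%:R^-1 <= (k_of c n)%:R / n%:R - ln (n%:R : R) <= c.
Proof.
move=> n0; have nR : 0 < n%:R :> R by rewrite ltr0n.
have l0 : 0 <= ln (n%:R : R) by rewrite ln_ge0 // ler1n.
set x := n%:R * ln (n%:R : R) + c * n%:R.
have x0 : 0 <= x by rewrite addr_ge0 ?mulr_ge0 // ltW.
have /andP[kx xk] := truncn_itv x0; rewrite -/(k_of c n) in kx xk.
rewrite -natr1 in xk.
have xE : x / n%:R = ln n%:R + c by rewrite /x; field; rewrite gt_eqF.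
have k1 : (k_of c n)%:R / n%:R <= ln n%:R + c by rewrite -xE ler_pM2r ?invr_gt0.
have k2 : ln n%:R + c <= ((k_of c n)%:R + 1) / n%:R.
  by rewrite -xE ler_pM2r ?invr_gt0 // ltW.
by rewrite mulrDl mul1r in k2; apply/andP; split; lra.
Qed.

Lemma cvg_k_of_div : (k_of c n)%:R / n%:R - ln (n%:R : R) @[n --> \oo] --> c.
Proof.
apply: (@squeeze_cvgr _ _ _ _ (fun n => c - n%:R^-1) (fun=> c)).
- by near=> n; apply: k_of_div_bounds; near: n; exact: nbhs_infty_gt.
- rewrite -[X in _ --> X]subr0; apply: cvgB (@cvg_invn R); exact: cvg_cst.
- exact: cvg_cst.
Unshelve. all: by end_near. Qed.

Lemma cvg_invn_pred : n.-1%:R^-1 @[n --> \oo] --> (0 : R).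
Proof. by rewrite -(cvg_shiftS (fun n => n.-1%:R^-1 : R)); exact: cvg_invn. Qed.

(** k/(n(n-1)) is of order (ln n)/n; this is the size of the error terms in
    both exponents. *)
Lemma cvg_k_of_div2 :
  (k_of c n)%:R / n%:R / n.-1%:R @[n --> \oo] --> (0 : R).
Proof.
have : ((k_of c n)%:R / n%:R - ln (n%:R : R)) * n.-1%:R^-1 + ln n%:R / n.-1%:R
    @[n --> \oo] --> c * 0 + 0.
  apply: cvgD (@cvg_ln_div R); exact: cvgM cvg_k_of_div cvg_invn_pred.
rewrite mulr0 addr0; under eq_fun do rewrite mulrBl addrNK.
by [].
Qed.

Lemma cvg_y_low : n%:R * y_low R (k_of c n) n @[n --> \oo] --> expR (- c).
Proof.
(* 1/(n-1) = 1/n + 1/(n(n-1)) *)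
have : expR (- ((k_of c n)%:R / n%:R - ln (n%:R : R)) -
             (k_of c n)%:R / n%:R / n.-1%:R) @[n --> \oo] --> expR (- c - 0).
  apply: cvg_expR_seq; apply: cvgB cvg_k_of_div2; exact: cvgN cvg_k_of_div.
rewrite subr0; apply: cvg_trans; apply: near_eq_cvg; near=> n.
have n1 : (1 < n)%N by near: n; exact: nbhs_infty_gt.
have n0 : (0 < n)%N by exact: ltnW.
have nR : 0 < n%:R :> R by rewrite ltr0n.
have mR : 0 < n.-1%:R :> R by rewrite ltr0n -ltnS prednK.
transitivity (expR (ln n%:R) * y_low R (k_of c n) n); last by rewrite lnK ?posrE.
rewrite /y_low -expRD; congr expR.
have -> : n%:R = n.-1%:R + 1 :> R by rewrite natr1 prednK.
by field; rewrite gt_eqF //= natr1 pnatr_eq0.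
Unshelve. all: by end_near. Qed.

Lemma cvg_y_upp : n%:R * y_upp R (k_of c n) n @[n --> \oo] --> expR (- c).
Proof.
(* 1/(n-1)^2 = (1 + 1/(n-1)) / (n(n-1)) *)
have : expR (- ((k_of c n)%:R / n%:R - ln (n%:R : R)) +
             (k_of c n)%:R / n%:R / n.-1%:R * (1 + n.-1%:R^-1))
    @[n --> \oo] --> expR (- c + 0 * (1 + 0)).
  apply: cvg_expR_seq; apply: cvgD; first exact: cvgN cvg_k_of_div.
  apply: cvgM cvg_k_of_div2 _; apply: cvgD cvg_invn_pred; exact: cvg_cst.
rewrite mul0r addr0; apply: cvg_trans; apply: near_eq_cvg; near=> n.
have n1 : (1 < n)%N by near: n; exact: nbhs_infty_gt.
have n0 : (0 < n)%N by exact: ltnW.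
have nR : 0 < n%:R :> R by rewrite ltr0n.
have mR : 0 < n.-1%:R :> R by rewrite ltr0n -ltnS prednK.
transitivity (expR (ln n%:R) * y_upp R (k_of c n) n); last by rewrite lnK ?posrE.
rewrite /y_upp -expRD; congr expR.
have -> : n%:R = n.-1%:R + 1 :> R by rewrite natr1 prednK.
by field; rewrite gt_eqF //= natr1 pnatr_eq0.
Unshelve. all: by end_near. Qed.
End Scaling.

(** * The logarithmic series *)

(** The remainder g vanishes at 0 and has derivative x^N/(1-x), since the
    derivatives of the terms form a finite geometric series; the mean value
    theorem on [0, u] bounds it. *)
Lemma le_lnB_sum (R : realType) (u : R) (N : nat) : 0 < u < 1 ->
  0 <= - ln (1 - u) - \sum_(0 <= j < N) u ^+ j.+1 / j.+1%:R <=
  u ^+ N * (u / (1 - u)).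
Proof.
move=> /andP[u0 u1].
pose g (x : R) := - ln (1 - x) - \sum_(0 <= j < N) x ^+ j.+1 / j.+1%:R.
pose dg (x : R) := x ^+ N / (1 - x).
have gE : g = (fun x : R => - ln (1 - x)) -
    \sum_(j < N) (fun x : R => j.+1%:R^-1 * x ^+ j.+1).
  apply/funext => x; rewrite /g big_mkord !fctE; congr (_ - _).
  by rewrite fct_sumE; apply: eq_bigr => j _; rewrite mulrC.
have dgP (x : R) : x < 1 -> is_derive x 1 g (dg x).
  move=> x1; have z0 : 0 < 1 - x by rewrite subr_gt0.
  have -> : dg x = - ((1 - x)^-1 * (0 - 1)) - \sum_(j < N) x ^+ j.
    have S : (1 - x) * \sum_(j < N) x ^+ j = 1 - x ^+ N.
      by rewrite -opprB mulNr -subrX1 opprB.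
    apply: (mulfI (lt0r_neq0 z0)); rewrite mulrBr S /dg.
    by field; rewrite gt_eqF.
  rewrite gE; apply: is_deriveB.
    apply: is_deriveN; apply: (@is_derive1_comp R (@ln R) (fun x => 1 - x)).
      exact: is_derive1_ln.
  apply: is_derive_sum => j.
  have -> : (fun x : R => j.+1%:R^-1 * x ^+ j.+1) = j.+1%:R^-1 *: (@id R ^+ j.+1).
    by apply/funext => z; rewrite !fctE.
  apply: is_derive_eq; rewrite /= scaler1.
  by rewrite -[LHS]/(_ * (_ * _)) mulrA mulVf ?pnatr_eq0 // mul1r.
have g0 : g 0 = 0.
  rewrite /g subr0 ln1 oppr0 big1 ?subr0 // => j _.
  by rewrite expr0n mul0r.
have [x /[!in_itv]/= /andP[x0 xu]] : exists2 x, x \in `]0, u[%R &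
    g u - g 0 = dg x * (u - 0).
  apply: MVT => //.
  - by move=> x /[!in_itv]/= /andP[_ xu]; apply: dgP; exact: lt_trans xu u1.
  - apply: derivable_within_continuous => x /[!in_itv]/= /andP[_ xu].
    by have [] := dgP x (le_lt_trans xu u1).
rewrite g0 !subr0 -/(g u) => ->; rewrite /dg.
have z0 : 0 < 1 - x by rewrite subr_gt0 (lt_trans xu).
have w0 : 0 < 1 - u by rewrite subr_gt0.
rewrite !mulr_ge0 ?exprn_ge0 ?invr_ge0 ?(ltW x0) ?(ltW u0) ?(ltW z0) //=.
rewrite -mulrA ler_pM ?exprn_ge0 ?mulr_ge0 ?invr_ge0 ?(ltW x0) ?(ltW u0) ?(ltW z0) //.
  by rewrite lerXn2r ?nnegrE ?(ltW x0) ?(ltW u0) ?(ltW xu).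
rewrite mulrC ler_pM2l // lef_pV2 ?posrE // lerD2l lerN2 ltW //.
Qed.

Lemma cvg_psum_ge2 (R : realType) (c : R) : 0 < c ->
  psum_ge2 c N @[N --> \oo] --> - ln (1 - expR (- c)) - expR (- c).
Proof.
move=> c0; set u := expR (- c).
have u0 : 0 < u by exact: expR_gt0.
have u1 : u < 1 by rewrite expR_lt1 oppr_lt0.
pose s N := \sum_(0 <= j < N) u ^+ j.+1 / j.+1%:R.
have sc : s N @[N --> \oo] --> - ln (1 - u).
  apply: (@squeeze_cvgr _ _ _ _ (fun N => - ln (1 - u) - u ^+ N * (u / (1 - u)))
            (fun=> - ln (1 - u))).
  - apply: nearW => N; have := @le_lnB_sum R u N.
    by rewrite u0 u1 => /(_ isT); rewrite -/(s N) => /andP[] *; apply/andP; split; lra.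
  - rewrite -[X in _ --> X]subr0; apply: cvgB; first exact: cvg_cst.
    rewrite -[X in _ --> X](mul0r (u / (1 - u))); apply: cvgM; last exact: cvg_cst.
    by apply: cvg_expr; rewrite gtr0_norm.
  - exact: cvg_cst.
rewrite -(cvg_shiftn 2).
have : s N.+1 - u @[N --> \oo] --> - ln (1 - u) - u.
  apply: cvgB; last exact: cvg_cst.
  by rewrite (cvg_shiftS s).
apply: cvg_trans; apply: near_eq_cvg; apply: nearW => N /=.
rewrite /s big_nat_recl // expr1 divr1 addrC addKr /psum_ge2 addn2.
rewrite !big_add1 /=; apply: eq_bigr => j _.
by rewrite -mulrN expRM_natl.
Qed.

(** * The limit of ell *)

Theorem mainTheorem4 (R : realType) (c : R) (hc : 0 < c) :
  [/\ cvgn (psum_ge2 c),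
      asymp_equiv (fun n : nat => ell (theta_of R n) (k_of c n) n)
        (fun _ : nat => expR (limn (psum_ge2 c)))
    & expR (limn (psum_ge2 c)) = expR (- expR (- c)) / (1 - expR (- c))].
Proof.
have sc := cvg_psum_ge2 hc.
have u0 : 0 < expR (- c) by exact: expR_gt0.
have u1 : expR (- c) < 1 by rewrite expR_lt1 oppr_lt0.
have eq_lim : expR (limn (psum_ge2 c)) = expR (- expR (- c)) / (1 - expR (- c)).
  rewrite (cvg_lim _ sc) // addrC expRD [expR (- ln _)]expRN lnK //.
  by rewrite posrE subr_gt0.
split => //; first by apply/cvg_ex; exists (- ln (1 - expR (- c)) - expR (- c)).
rewrite /asymp_equiv eq_lim; set L := expR _ / _.
have L0 : L != 0 by rewrite mulf_neq0 ?invr_eq0 ?expR_eq0 // gt_eqF // subr_gt0.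
rewrite -[X in _ --> X](divff L0); apply: cvgM; last exact: cvg_cst.
apply: (@squeeze_cvgr _ _ _ _
  (fun n => nonfixed_gf n (y_low R (k_of c n) n))
  (fun n => nonfixed_gf n (y_upp R (k_of c n) n))).
- by near=> n; apply: ell_sandwich; near: n; exact: nbhs_infty_gt.
- apply: cvg_nonfixed_gf (cvg_y_low hc); first by rewrite u0.
  by move=> n; exact: expR_ge0.
- apply: cvg_nonfixed_gf (cvg_y_upp hc); first by rewrite u0.
  by move=> n; exact: expR_ge0.
Unshelve. all: by end_near. Qed.
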